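(* For every $n\ge 1$, $$\sum_{\pi\in\mathfrak{S}_n,\ \mathcal{T}^2(\pi)=\mathrm{id}} x^{1+\mathrm{des}(\pi)} \;=\; \sum_{\pi\in\mathfrak{S}_n,\ \mathcal{S}^2(\pi)=\mathrm{id}} x^{1+\mathrm{des}(\pi)}.$$
   Context: $\mathfrak{S}_n$ is the set of permutations of $\{1,\ldots,n\}$, written as words; $\mathrm{id}=12\cdots n$; $\mathrm{des}(\pi)$ is the number of indices $i$ with $\pi_i>\pi_{i+1}$. The operators $\mathcal{S}$ (stack sort) and $\mathcal{T}$ (revstack sort) are defined recursively on finite words of distinct positive integers: both fix the empty word and words of length 1, and $\mathcal{S}(LmR)=\mathcal{S}(L)\,\mathcal{S}(R)\,m$, $\mathcal{T}(LmR)=\mathcal{T}(R)\,\mathcal{T}(L)\,m$, where $m$ is the largest entry of $LmR$. $\mathcal{S}^2=\mathcal{S}\circ\mathcal{S}$ and $\mathcal{T}^2=\mathcal{T}\circ\mathcal{T}$. *)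

(* Defs.v *)
From mathcomp Require Import all_boot all_order all_algebra.
Set Implicit Arguments.
Unset Strict Implicit.
Unset Printing Implicit Defensive.

(* Words are values of type seq nat; the words of the permutations of          *)
(* {1, ..., n} are the members of permutations (iota 1 n).                     *)

Definition max_entry (w : seq nat) : nat := foldr maxn 0 w.

Definition left_part (w : seq nat) : seq nat := take (index (max_entry w) w) w.

Definition right_part (w : seq nat) : seq nat :=
  drop (index (max_entry w) w).+1 w.

(* k only bounds the recursion depth; size w is always enough, as the lemmas   *)
(* stack_sortE and revstack_sortE show.                                        *)
Fixpoint stack_sort_rec (k : nat) (w : seq nat) : seq nat :=
  match k, w with
  | k'.+1, _ :: _ =>
      stack_sort_rec k' (left_part w) ++ stack_sort_rec k' (right_part w)
        ++ [:: max_entry w]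
  | _, _ => [::]
  end.

Definition stack_sort (w : seq nat) : seq nat := stack_sort_rec (size w) w.

Fixpoint revstack_sort_rec (k : nat) (w : seq nat) : seq nat :=
  match k, w with
  | k'.+1, _ :: _ =>
      revstack_sort_rec k' (right_part w) ++ revstack_sort_rec k' (left_part w)
        ++ [:: max_entry w]
  | _, _ => [::]
  end.

Definition revstack_sort (w : seq nat) : seq nat :=
  revstack_sort_rec (size w) w.

(* Positions are counted from 0.                                               *)
Definition des (w : seq nat) : nat :=
  count (fun i => nth 0 w i.+1 < nth 0 w i) (iota 0 (size w).-1).

Lemma max_entry_in (x : nat) (w : seq nat) : max_entry (x :: w) \in x :: w.
Proof.
elim: w x => [|y w IH] x; first by rewrite /= maxn0 mem_head.
rewrite /max_entry /= -/(max_entry w) -[maxn y _]/(max_entry (y :: w)).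
by rewrite /maxn; case: ifP => _; rewrite inE ?eqxx // IH orbT.
Qed.

Lemma size_left_part (x : nat) (w : seq nat) :
  size (left_part (x :: w)) <= size w.
Proof.
have lt_i : index (max_entry (x :: w)) (x :: w) < size (x :: w).
  by rewrite index_mem max_entry_in.
by rewrite /left_part size_takel // ltnW.
Qed.

Lemma size_right_part (x : nat) (w : seq nat) :
  size (right_part (x :: w)) <= size w.
Proof. by rewrite /right_part size_drop /= subSS leq_subr. Qed.

Lemma stack_sort_rec_size (k : nat) (w : seq nat) :
  size w <= k -> stack_sort_rec k w = stack_sort w.
Proof.
rewrite /stack_sort; elim/ltn_ind: k w => -[|k] IH [|x w] //= le_wk.
have IHw u : size u <= size w -> stack_sort_rec k u = stack_sort_rec (size w) u.
  move=> le_uw; rewrite IH ?(leq_trans le_uw) //.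
  by rewrite (IH (size w)) // ltnS.
by rewrite !IHw ?size_left_part ?size_right_part.
Qed.

Lemma revstack_sort_rec_size (k : nat) (w : seq nat) :
  size w <= k -> revstack_sort_rec k w = revstack_sort w.
Proof.
rewrite /revstack_sort; elim/ltn_ind: k w => -[|k] IH [|x w] //= le_wk.
have IHw u :
    size u <= size w -> revstack_sort_rec k u = revstack_sort_rec (size w) u.
  move=> le_uw; rewrite IH ?(leq_trans le_uw) //.
  by rewrite (IH (size w)) // ltnS.
by rewrite !IHw ?size_left_part ?size_right_part.
Qed.

Section Decomposition.

Variables (L R : seq nat) (m : nat).
Hypotheses (ltLm : all (fun a => a < m) L) (ltRm : all (fun a => a < m) R).

Lemma max_entry_cat : max_entry (L ++ m :: R) = m.
Proof using ltLm ltRm.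
have maxR : max_entry (m :: R) = m.
  rewrite /max_entry /=; apply/maxn_idPl.
  elim: R ltRm => //= a R' IH /andP[/ltnW le_am /IH].
  by rewrite geq_max le_am.
elim: L ltLm => //= a L' IH /andP[/ltnW le_am /IH].
by rewrite /max_entry /= => ->; apply/maxn_idPr.
Qed.

Lemma index_max_cat : index m (L ++ m :: R) = size L.
Proof using ltLm.
rewrite index_cat /= eqxx addn0; case: ifP => // /(allP ltLm).
by rewrite ltnn.
Qed.

Lemma left_part_cat : left_part (L ++ m :: R) = L.
Proof using ltLm ltRm.
by rewrite /left_part max_entry_cat index_max_cat take_size_cat.
Qed.

Lemma right_part_cat : right_part (L ++ m :: R) = R.
Proof using ltLm ltRm.
rewrite /right_part max_entry_cat index_max_cat -cat_rcons.
by rewrite drop_size_cat // size_rcons.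
Qed.

Lemma stack_sortE :
  stack_sort (L ++ m :: R) = stack_sort L ++ stack_sort R ++ [:: m].
Proof using ltLm ltRm.
have := (left_part_cat, right_part_cat, max_entry_cat).
rewrite /stack_sort; case: (L ++ m :: R) (size_cat L (m :: R)) => [|x w] /=.
  by rewrite addnS.
rewrite addnS => -[->] E; rewrite !E.
by rewrite !stack_sort_rec_size // ?leq_addr ?leq_addl.
Qed.

Lemma revstack_sortE :
  revstack_sort (L ++ m :: R) = revstack_sort R ++ revstack_sort L ++ [:: m].
Proof using ltLm ltRm.
have := (left_part_cat, right_part_cat, max_entry_cat).
rewrite /revstack_sort; case: (L ++ m :: R) (size_cat L (m :: R)) => [|x w] /=.
  by rewrite addnS.
rewrite addnS => -[->] E; rewrite !E.
by rewrite !revstack_sort_rec_size // ?leq_addr ?leq_addl.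
Qed.

End Decomposition.

(* Main.v *)
Require Import Defs.
From mathcomp Require Import all_boot all_order all_algebra.
Import GRing.Theory.

(** Write S and T for stack_sort and revstack_sort.  A word of distinct entries
    is a decreasing binary tree: the root of L m R, with m the largest entry,
    is m, and its subtrees are those of L and R.  In these terms S reads the
    tree in postorder, T reads it in the mirrored postorder, and des counts the
    right edges.  The equality follows from two bijections that preserve des.

    First, exchange the two subtrees of every node that has two children and
    leave the other nodes alone.  This is an involution [swap] that keeps the
    number of right edges and satisfies S (swap w) = T w.  Hence the
    permutations with T (T w) = id correspond to those with T (S u) = id.

    Second, fix u and let p = S u.  Every subtree of u occupies a factor of p,
    and its root is the maximum of that factor.  So a relabelling phi that
    sends the maximum of each factor of p to the maximum of its image
    ([max_preserving]) keeps the tree shape of p and also the one of u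
    ([max_preserving_stack_sort]); therefore S and T commute with phi and des
    does not change.  For B equal to S or T, the function sending an entry to
    its position in B p is such a relabelling, because both postorders put a
    root after its descendants; after it, B p becomes id.  Thus relabelling u
    by the positions in S (S u) leads from T (S u) = id to S (S u) = id, and
    relabelling by the positions in T (S u) leads back ([relabel_tree_sort]). *)

(** * Words as decreasing trees *)

Lemma leq_max_entry {x : nat} {w : seq nat} : x \in w -> x <= max_entry w.
Proof.
elim: w => //= y w IH; rewrite inE leq_max => /orP[/eqP-> | /IH->].
  by rewrite leqnn.
by rewrite orbT.
Qed.

Lemma max_entry_mem {x : nat} {w : seq nat} : x \in w -> max_entry w \in w.
Proof. by case: w => // y w _; apply: max_entry_in. Qed.

Lemma max_entry_eq {m : nat} {w : seq nat} :
  m \in w -> {in w, forall x, x <= m} -> max_entry w = m.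
Proof.
move=> mw le_m; apply/eqP; rewrite eqn_leq leq_max_entry // andbT.
exact: le_m (max_entry_mem mw).
Qed.

Lemma max_split {w : seq nat} :
  w != [::] -> uniq w ->
  [/\ w = left_part w ++ max_entry w :: right_part w,
      all (fun a => a < max_entry w) (left_part w)
    & all (fun a => a < max_entry w) (right_part w)].
Proof.
case: w => // x w _; set v := x :: w => uv.
have mv : max_entry v \in v by apply: max_entry_in.
have vE : v = left_part v ++ max_entry v :: right_part v.
  have := cat_take_drop (index (max_entry v) v) v.
  by rewrite (drop_nth 0) ?index_mem // nth_index.
have := uv; rewrite {1}vE cat_uniq /= => /and3P[_ /norP[mL _] /andP[mR _]].
have max_lt a : a \in v -> a != max_entry v -> a < max_entry v.
  by move=> av; rewrite ltn_neqAle leq_max_entry // => ->.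
have mem_v a : a \in left_part v ++ right_part v -> a \in v.
  by rewrite [in _ \in v]vE !mem_cat inE => /orP[]->; rewrite ?orbT.
split=> //; apply/allP => a aP; apply: max_lt.
- by rewrite mem_v // mem_cat aP.
- by apply/eqP => aE; rewrite aE in aP; case/negP: mL.
- by rewrite mem_v // mem_cat aP orbT.
by apply/eqP => aE; rewrite aE in aP; case/negP: mR.
Qed.

(** Structural induction on the decreasing tree of a word. *)
Lemma max_split_ind (P : seq nat -> Prop) :
  P [::] ->
  (forall L m R, all (fun a => a < m) L -> all (fun a => a < m) R ->
     uniq (L ++ m :: R) -> P L -> P R -> P (L ++ m :: R)) ->
  forall w, uniq w -> P w.
Proof.
move=> P0 PS w; have [k] := ubnP (size w); elim: k w => // k IH w lewk uw.
have [->|w0] := eqVneq w [::]; first exact: P0.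
have [wE ltL ltR] := max_split w0 uw.
move: uw lewk; rewrite wE size_cat /= addnS !ltnS => uw lek.
have := uw; rewrite cat_uniq /= => /and3P[uL _ /andP[_ uR]].
apply: PS => //; apply: IH => //; apply: leq_trans lek; rewrite ltnS.
  exact: leq_addr.
exact: leq_addl.
Qed.

Lemma uniq_cat_consP {L : seq nat} {m : nat} {R : seq nat} :
  uniq (L ++ m :: R) -> uniq L /\ uniq R.
Proof. by rewrite cat_uniq /= => /and3P[-> _ /andP[_ ->]]. Qed.

Lemma perm_stack_sort {w : seq nat} : uniq w -> perm_eq (stack_sort w) w.
Proof.
move: w; apply: max_split_ind => // L m R ltL ltR _ IHL IHR.
rewrite stack_sortE // perm_cat //.
by rewrite perm_catC /= perm_cons.
Qed.

(** Reversing a word mirrors its tree. *)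
Lemma revstack_sort_rev {w : seq nat} :
  uniq w -> revstack_sort w = stack_sort (rev w).
Proof.
move: w; apply: max_split_ind => // L m R ltL ltR _ IHL IHR.
rewrite rev_cat rev_cons cat_rcons stack_sortE ?all_rev //.
by rewrite revstack_sortE // IHL IHR.
Qed.

Lemma des_cons2 (x y : nat) (w : seq nat) :
  des [:: x, y & w] = (y < x) + des (y :: w).
Proof. by rewrite /des /= (iotaDl 1 0) count_map. Qed.

(** All entries of L and R are below m, so there is no descent from L to m,
    and there is one from m to R as soon as R is nonempty: this is the right
    edge at the root. *)
Lemma des_cat {L : seq nat} {m : nat} {R : seq nat} :
  all (fun a => a < m) L -> all (fun a => a < m) R ->
  des (L ++ m :: R) = des L + des R + (R != [::]).
Proof.
move=> ltL ltR; elim: L ltL => [_|x [|y L] IH] /=.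
- by case: R ltR => // y R /= /andP[lt_ym _]; rewrite des_cons2 lt_ym addnC.
- rewrite andbT => lt_xm; rewrite des_cons2 ltnNge ltnW //=.
  exact: (IH isT).
by case/andP=> _ ltL; rewrite !des_cons2 -!addnA -cat_cons IH // !addnA.
Qed.

(** * Exchanging the subtrees of nodes with two children *)

(** When one of L, R is empty, L m R and R m L have the same postorder but not
    the same number of right edges; hence the case distinction. *)
Definition swap_join (L : seq nat) (m : nat) (R : seq nat) : seq nat :=
  if (L == [::]) || (R == [::]) then L ++ m :: R else R ++ m :: L.

Fixpoint swap_rec (k : nat) (w : seq nat) : seq nat :=
  match k, w with
  | k'.+1, _ :: _ =>
      swap_join (swap_rec k' (left_part w)) (max_entry w)
        (swap_rec k' (right_part w))
  | _, _ => [::]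
  end.

Definition swap (w : seq nat) : seq nat := swap_rec (size w) w.

Lemma swap_rec_size (k : nat) (w : seq nat) :
  size w <= k -> swap_rec k w = swap w.
Proof.
rewrite /swap; elim/ltn_ind: k w => -[|k] IH [|x w] //= le_wk.
have IHw u : size u <= size w -> swap_rec k u = swap_rec (size w) u.
  move=> le_uw; rewrite IH ?(leq_trans le_uw) //.
  by rewrite (IH (size w)) // ltnS.
by rewrite !IHw ?size_left_part ?size_right_part.
Qed.

Lemma swapE {L : seq nat} {m : nat} {R : seq nat} :
  all (fun a => a < m) L -> all (fun a => a < m) R ->
  swap (L ++ m :: R) = swap_join (swap L) m (swap R).
Proof.
move=> ltL ltR.
have := (left_part_cat ltL ltR, right_part_cat ltL ltR, max_entry_cat ltL ltR).
rewrite {1}/swap; case: (L ++ m :: R) (size_cat L (m :: R)) => [|x w] /=.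
  by rewrite addnS.
rewrite addnS => -[->] E; rewrite !E.
by rewrite !swap_rec_size // ?leq_addr ?leq_addl.
Qed.

Lemma perm_swap {w : seq nat} : uniq w -> perm_eq (swap w) w.
Proof.
move: w; apply: max_split_ind => // L m R ltL ltR _ IHL IHR.
rewrite swapE // /swap_join; case: ifP => _; first by rewrite perm_cat // perm_cons.
by rewrite perm_catC -[L ++ _]cat_rcons perm_cat //
   perm_sym perm_rcons perm_cons perm_sym.
Qed.

Lemma all_swap {m : nat} {w : seq nat} :
  uniq w -> all (fun a => a < m) w -> all (fun a => a < m) (swap w).
Proof. by move=> uw; rewrite (perm_all _ (perm_swap uw)). Qed.

Lemma swap_nil {w : seq nat} : uniq w -> (swap w == [::]) = (w == [::]).
Proof. by move=> uw; rewrite -!size_eq0 (perm_size (perm_swap uw)). Qed.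

Lemma swapK {w : seq nat} : uniq w -> swap (swap w) = w.
Proof.
move: w; apply: max_split_ind => // L m R ltL ltR /uniq_cat_consP[uL uR] IHL IHR.
rewrite swapE // {1}/swap_join !swap_nil //; case: ifP => LR0.
  by rewrite swapE ?all_swap // IHL IHR /swap_join LR0.
by rewrite swapE ?all_swap // IHL IHR /swap_join orbC LR0.
Qed.

(** When one subtree is empty, S and T read the node in the same way, so only
    nodes with two children need the exchange. *)
Lemma stack_sort_swap {w : seq nat} :
  uniq w -> stack_sort (swap w) = revstack_sort w.
Proof.
move: w; apply: max_split_ind => // L m R ltL ltR /uniq_cat_consP[uL uR] IHL IHR.
rewrite swapE // /swap_join !swap_nil //; case: ifP => LR0.
  rewrite stack_sortE ?all_swap // revstack_sortE // IHL IHR.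
  by case/orP: LR0 => /eqP->; rewrite /= ?cats0.
by rewrite stack_sortE ?all_swap // revstack_sortE // IHL IHR.
Qed.

Lemma des_swap {w : seq nat} : uniq w -> des (swap w) = des w.
Proof.
move: w; apply: max_split_ind => // L m R ltL ltR /uniq_cat_consP[uL uR] IHL IHR.
rewrite swapE // /swap_join !swap_nil //; case: ifP => LR0.
  by rewrite !des_cat ?all_swap // IHL IHR swap_nil.
rewrite !des_cat ?all_swap // IHL IHR swap_nil // (addnC (des R)).
by case/norP: (negbT LR0) => -> ->.
Qed.

(** * Relabellings that respect the maxima of factors *)

Definition max_preserving (phi : nat -> nat) (w : seq nat) : Prop :=
  forall v a, infix v w -> a \in v -> a < max_entry v ->
    phi a < phi (max_entry v).

Lemma max_preserving_infix {phi : nat -> nat} {v w : seq nat} :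
  infix v w -> max_preserving phi w -> max_preserving phi v.
Proof. by move=> vw H u a uv; apply: H (infix_trans uv vw). Qed.

Lemma max_preserving_rev {phi : nat -> nat} {w : seq nat} :
  max_preserving phi w -> max_preserving phi (rev w).
Proof.
move=> H v a vw av.
have <- : max_entry (rev v) = max_entry v.
  apply: max_entry_eq; first by rewrite mem_rev (max_entry_mem av).
  by move=> x; rewrite mem_rev; apply: leq_max_entry.
by apply: H; rewrite ?mem_rev // infix_revLR.
Qed.

(** A factor of L m R that avoids m lies on one side of it. *)
Lemma infix_cat_cons {L : seq nat} {m : nat} {R v : seq nat} :
  infix v (L ++ m :: R) -> [\/ infix v L, m \in v | infix v R].
Proof.
case/infixP=> p [s E].
have [le_pv|lt_pv] := leqP (size (p ++ v)) (size L).
  constructor 1; rewrite -(take_size_cat (s1 := L) (m :: R) erefl) E.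
  rewrite catA take_cat -if_neg -leqNgt le_pv -catA.
  exact: infix_infix.
have [le_p|lt_p] := leqP (size p) (size L); last first.
  (* v starts strictly after m. *)
  constructor 3; have -> : R = drop (size L).+1 (p ++ v ++ s).
    by rewrite -E -cat_rcons drop_size_cat // size_rcons.
  have -> : p = take (size L).+1 p ++ drop (size L).+1 p by rewrite cat_take_drop.
  rewrite -catA drop_size_cat ?size_takel //; exact: infix_infix.
constructor 2; have -> : m = nth 0 (p ++ v ++ s) (size L).
  by rewrite -E nth_cat ltnn subnn.
rewrite size_cat in lt_pv.
rewrite nth_cat ltnNge le_p /= nth_cat ltn_subLR // lt_pv mem_nth //.
by rewrite ltn_subLR.
Qed.

(** The factors that contain m have maximum m, and the other ones are factors
    of a subtree: it is enough to test the subtrees and the root. *)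
Lemma max_preserving_cat {phi : nat -> nat} {L : seq nat} {m : nat}
    {R : seq nat} :
  all (fun a => a < m) L -> all (fun a => a < m) R ->
  max_preserving phi L -> max_preserving phi R ->
  {in L ++ R, forall a, phi a < phi m} ->
  max_preserving phi (L ++ m :: R).
Proof.
move=> ltL ltR HL HR Hm v a vw av.
have [/HL|mv|/HR] := infix_cat_cons vw; try exact.
have -> : max_entry v = m.
  rewrite -(max_entry_cat ltL ltR); apply: max_entry_eq.
    by rewrite max_entry_cat.
  by move=> x /(mem_infix vw); apply: leq_max_entry.
move=> lt_am; apply: Hm; have := mem_infix vw av.
by rewrite !mem_cat inE (ltn_eqF lt_am).
Qed.

Lemma max_preserving_catP {phi : nat -> nat} {L : seq nat} {m : nat}
    {R : seq nat} :
  all (fun a => a < m) L -> all (fun a => a < m) R ->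
  max_preserving phi (L ++ m :: R) ->
  [/\ max_preserving phi L, max_preserving phi R
    & {in L ++ R, forall a, phi a < phi m}].
Proof.
move=> ltL ltR H; split.
- exact: max_preserving_infix (prefix_infix _ _) H.
- by apply: max_preserving_infix H; rewrite -cat_rcons suffix_infix.
move=> a aLR; rewrite -(max_entry_cat ltL ltR); apply: H => //.
- exact: infix_refl.
- by move: aLR; rewrite !mem_cat inE => /orP[]->; rewrite ?orbT.
rewrite max_entry_cat //; move: aLR; rewrite mem_cat.
by case/orP; [move/(allP ltL) | move/(allP ltR)].
Qed.

Lemma max_preserving_map {phi : nat -> nat} {L : seq nat} {m : nat}
    {R : seq nat} :
  {in L ++ R, forall a, phi a < phi m} ->
  all (fun a => a < phi m) (map phi L) /\ all (fun a => a < phi m) (map phi R).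
Proof.
move=> H; rewrite !all_map; split; apply/allP => a aw /=; apply: H.
  by rewrite mem_cat aw.
by rewrite mem_cat aw orbT.
Qed.

(** A relabelling that preserves the maxima of factors maps the root of each
    subtree to the root of its image, so it does not change the tree shape. *)
Lemma stack_sort_map {phi : nat -> nat} {w : seq nat} :
  uniq w -> max_preserving phi w ->
  stack_sort (map phi w) = map phi (stack_sort w).
Proof.
move: w; apply: max_split_ind => // L m R ltL ltR _ IHL IHR.
case/(max_preserving_catP ltL ltR) => /IHL{}IHL /IHR{}IHR.
case/max_preserving_map=> ltL' ltR'.
by rewrite map_cat /= !stack_sortE // IHL IHR !map_cat.
Qed.

Lemma des_map {phi : nat -> nat} {w : seq nat} :
  uniq w -> max_preserving phi w -> des (map phi w) = des w.
Proof.
move: w; apply: max_split_ind => // L m R ltL ltR _ IHL IHR.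
case/(max_preserving_catP ltL ltR) => /IHL{}IHL /IHR{}IHR.
case/max_preserving_map=> ltL' ltR'.
by rewrite map_cat /= !des_cat // IHL IHR -!size_eq0 size_map.
Qed.

(** Each subtree L m R of w appears in postorder as the factor
    S(L) S(R) m of S(w), whose maximum is m.  The maxima of the factors of
    S(w) therefore control all roots in w, hence all factors of w. *)
Lemma max_preserving_stack_sort {phi : nat -> nat} {w : seq nat} :
  uniq w -> max_preserving phi (stack_sort w) -> max_preserving phi w.
Proof.
move: w; apply: max_split_ind => // L m R ltL ltR uw IHL IHR.
have [uL uR] := uniq_cat_consP uw.
rewrite stack_sortE // => H; apply: max_preserving_cat => //.
- exact: IHL (max_preserving_infix (prefix_infix _ _) H).
- exact: IHR (max_preserving_infix (infix_infix _ _ _) H).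
(* S(L) S(R) m is a word with root m, left subtree S(L) S(R) and no right
   subtree. *)
rewrite catA in H; case/max_preserving_catP: H => //.
  by rewrite all_cat !(perm_all _ (perm_stack_sort _)) ?ltL.
move=> _ _ H a; rewrite mem_cat => aLR; apply: H.
by rewrite cats0 mem_cat !(perm_mem (perm_stack_sort _)).
Qed.

(** * Relabelling by the position in a sorted word *)

(** Positions are counted from 1, so that a word of length n relabelled by
    its own ranks is 1 2 ... n. *)
Definition rank (w : seq nat) (v : nat) : nat := (index v w).+1.

Lemma map_rank {w : seq nat} : uniq w -> map (rank w) w = iota 1 (size w).
Proof.
move=> uw; apply: (@eq_from_nth _ 0); first by rewrite size_map size_iota.
move=> i; rewrite size_map => lt_i.
by rewrite (nth_map 0) // nth_iota // /rank index_uniq.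
Qed.

Lemma rank_map {phi : nat -> nat} {w : seq nat} {v : nat} :
  {in w &, injective phi} -> v \in w -> rank (map phi w) (phi v) = rank w v.
Proof.
elim: w => //= x w IH inj vw; rewrite /rank /=.
rewrite (inj_in_eq inj) ?mem_head //; case: eqVneq => // nvx; congr _.+1.
apply: IH; last by move: vw; rewrite inE eq_sym (negPf nvx).
by move=> a b aw bw; apply: inj; rewrite inE ?aw ?bw orbT.
Qed.

(** In a postorder the root of a subtree comes after its descendants, so it has
    the largest rank; the ranks in S(R) are shifted by the length of S(L),
    which does not affect their order. *)
Lemma max_preserving_rank_sort {w : seq nat} :
  uniq w -> max_preserving (rank (stack_sort w)) w.
Proof.
move: w; apply: (max_split_ind (fun w => max_preserving (rank (stack_sort w)) w)).
  by move=> v a; rewrite infixs0 => /eqP->.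
move=> L m R ltL ltR uw IHL IHR.
have [uL uR] := uniq_cat_consP uw.
have mL := perm_mem (perm_stack_sort uL).
have mR := perm_mem (perm_stack_sort uR).
have := perm_uniq (perm_stack_sort uw); rewrite uw stack_sortE //.
rewrite catA cats1 rcons_uniq cat_uniq => /and3P[m_notin _ /andP[/hasPn RnL _]].
have rankL : {in L, rank (rcons (stack_sort L ++ stack_sort R) m) =1
                    rank (stack_sort L)}.
  by move=> a; rewrite -mL /rank -cats1 -catA index_cat => ->.
have rankR : {in R, forall a, rank (rcons (stack_sort L ++ stack_sort R) m) a =
                    size (stack_sort L) + rank (stack_sort R) a}.
  move=> a; rewrite -mR /rank -cats1 -catA index_cat => aR.
  by rewrite (negPf (RnL _ aR)) index_cat aR addnS.
apply: max_preserving_cat => //.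
- move=> v a vL av lt_a; rewrite !rankL; first exact: (IHL v).
    exact: mem_infix vL _ (max_entry_mem av).
  exact: mem_infix vL _ av.
- move=> v a vR av lt_a; rewrite !rankR; first by rewrite ltn_add2l; apply: (IHR v).
    exact: mem_infix vR _ (max_entry_mem av).
  exact: mem_infix vR _ av.
move=> a; rewrite mem_cat -mL -mR -mem_cat /rank -cats1 ltnS => aLR.
rewrite !index_cat aLR (negPf m_notin) /= eqxx addn0.
by rewrite -index_cat index_mem.
Qed.

(** What the relabelling argument uses of the outer sorting operator.  It is
    stated for an abstract operator so that the two directions of the
    bijection, where S and T exchange roles, are one lemma. *)
Record tree_sort (A : seq nat -> seq nat) : Prop := TreeSort {
  perm_tree_sort : forall w, uniq w -> perm_eq (A w) w;
  max_preserving_rank : forall w, uniq w -> max_preserving (rank (A w)) w;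
  tree_sort_map : forall phi w, uniq w -> max_preserving phi w ->
    A (map phi w) = map phi (A w)
}.

Arguments perm_tree_sort {A} _ {w} _.
Arguments max_preserving_rank {A} _ {w} _.
Arguments tree_sort_map {A} _ {phi w} _ _.

Lemma tree_sort_stack : tree_sort stack_sort.
Proof.
split; [exact: @perm_stack_sort | exact: @max_preserving_rank_sort |].
by move=> phi w; apply: stack_sort_map.
Qed.

Lemma tree_sort_revstack : tree_sort revstack_sort.
Proof.
split=> [w uw | w uw | phi w].
- by rewrite revstack_sort_rev // -(permPr (permEl (perm_rev w)))
     perm_stack_sort ?rev_uniq.
- rewrite revstack_sort_rev // -[w in max_preserving _ w]revK.
  by apply: max_preserving_rev; apply: max_preserving_rank_sort; rewrite rev_uniq.
move: w; apply: max_split_ind => // L m R ltL ltR _ IHL IHR.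
case/(max_preserving_catP ltL ltR) => /IHL{}IHL /IHR{}IHR.
case/max_preserving_map=> ltL' ltR'.
by rewrite map_cat /= !revstack_sortE // IHL IHR !map_cat.
Qed.

(** The relabelling phi turns B (S u) into the identity and A (S u) = id into
    phi(1) phi(2) ... phi(n).  The ranks in the latter word invert phi, which
    is why relabelling u' by A (S u') gives back u. *)
Lemma relabel_tree_sort {A B : seq nat -> seq nat} {n : nat} {u : seq nat}
    (u' := map (rank (B (stack_sort u))) u) :
  tree_sort A -> tree_sort B -> perm_eq u (iota 1 n) ->
  A (stack_sort u) = iota 1 n ->
  [/\ perm_eq u' (iota 1 n), B (stack_sort u') = iota 1 n,
      map (rank (A (stack_sort u'))) u' = u & des u' = des u].
Proof.
move=> sA sB un Au; have uu : uniq u by rewrite (perm_uniq un) iota_uniq.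
set phi := rank (B (stack_sort u)) in u' *.
have uSu : uniq (stack_sort u) by rewrite (perm_uniq (perm_stack_sort uu)).
have pB := perm_tree_sort sB uSu.
have uB : uniq (B (stack_sort u)) by rewrite (perm_uniq pB).
have pBu : perm_eq (B (stack_sort u)) u := perm_trans pB (perm_stack_sort uu).
have mS : max_preserving phi (stack_sort u) by apply: max_preserving_rank.
have mu : max_preserving phi u by apply: max_preserving_stack_sort.
have mapB : map phi (B (stack_sort u)) = iota 1 n.
  by rewrite map_rank // (perm_size pBu) (perm_size un) size_iota.
have Su' : stack_sort u' = map phi (stack_sort u) by apply: stack_sort_map.
have inj : {in iota 1 n &, injective phi}.
  move=> a b; rewrite -!(perm_mem un) -!(perm_mem pBu) => aB bB [].
  exact: index_inj.
have pu' : perm_eq u' (iota 1 n) by rewrite -mapB perm_map // perm_sym.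
split=> //; first by rewrite Su' tree_sort_map.
  rewrite Su' (tree_sort_map sA) // Au -map_comp map_id_in // => v vu /=.
  have vn : v \in iota 1 n by rewrite -(perm_mem un).
  rewrite rank_map //.
  have lt_n : index v (iota 1 n) < n by rewrite -{2}(size_iota 1 n) index_mem.
  by rewrite /rank -add1n -(nth_iota 0 1 lt_n) nth_index.
exact: des_map.
Qed.

Lemma big_pred_bij {T : eqType} {V : nmodType} {s : seq T} {P Q : pred T}
    {f g : T -> T} {F : T -> V} :
  uniq s ->
  {in s, forall x, P x -> [/\ f x \in s, Q (f x), g (f x) = x & F (f x) = F x]} ->
  {in s, forall y, Q y -> [/\ g y \in s, P (g y) & f (g y) = y]} ->
  (\sum_(x <- s | P x) F x = \sum_(y <- s | Q y) F y)%R.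
Proof.
move=> us fP gP; rewrite -big_filter -[RHS]big_filter.
have fK : {in [seq x <- s | P x], cancel f g}.
  by move=> x; rewrite mem_filter => /andP[Px xs]; case: (fP x xs Px).
have pf : perm_eq [seq y <- s | Q y] (map f [seq x <- s | P x]).
  apply: uniq_perm; rewrite ?filter_uniq //.
    by rewrite (map_inj_in_uniq (can_in_inj fK)) filter_uniq.
  move=> y; rewrite mem_filter; apply/andP/mapP => [[Qy ys] | [x]].
    by case: (gP y ys Qy) => gs Pg yE; exists (g y); rewrite // mem_filter Pg.
  by rewrite mem_filter => /andP[Px xs] ->; case: (fP x xs Px).
rewrite (perm_big _ pf) big_map; apply: eq_big_seq => x.
by rewrite mem_filter => /andP[Px xs]; case: (fP x xs Px).
Qed.

Local Open Scope ring_scope.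

Theorem theorem3p2 (n : nat) (n_ge1 : (1 <= n)%N) :
  \sum_(w <- permutations (iota 1 n) |
          revstack_sort (revstack_sort w) == iota 1 n)
     'X^(1 + des w) =
  \sum_(w <- permutations (iota 1 n) |
          stack_sort (stack_sort w) == iota 1 n)
     'X^(1 + des w) :> {poly int}.
Proof.
have uP := permutations_uniq (iota 1 n).
have uw w : perm_eq w (iota 1 n) -> uniq w by move/perm_uniq->; apply: iota_uniq.
transitivity (\sum_(w <- permutations (iota 1 n) |
  revstack_sort (stack_sort w) == iota 1 n) 'X^(1 + des w) : {poly int}).
  apply: (big_pred_bij (f := swap) (g := swap)) => // w.
    rewrite !mem_permutations => wn /eqP Tw; have u := uw w wn.
    by rewrite (perm_trans (perm_swap u)) // stack_sort_swap // Tw swapK // des_swap.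
  rewrite !mem_permutations => wn /eqP Tw; have u := uw w wn.
  have us : uniq (swap w) by rewrite (perm_uniq (perm_swap u)).
  by rewrite (perm_trans (perm_swap u)) // -(stack_sort_swap us) swapK // Tw.
apply: (big_pred_bij
  (f := fun w => map (rank (stack_sort (stack_sort w))) w)
  (g := fun w => map (rank (revstack_sort (stack_sort w))) w)) => // w.
  rewrite !mem_permutations => wn /eqP Tw.
  have [] := relabel_tree_sort tree_sort_revstack tree_sort_stack wn Tw.
  by move=> -> -> -> ->.
rewrite !mem_permutations => wn /eqP Sw.
have [] := relabel_tree_sort tree_sort_stack tree_sort_revstack wn Sw.
by move=> -> -> -> _.
Qed.
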